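(* Let $A$ be a complex antidiagonal matrix of size $n$. (a) If $n$ is even, then $A$ is permutation-similar to a hollow quasidiagonal matrix. If $n$ is odd, then $A$ is permutation-similar to a pseudo-hollow quasidiagonal matrix. In particular, if $A$ is written in the standard form described in the context with entries $a_1,\dots,a_n$, then $A = PQP^{-1}$, where: For $n=2m$ even, $P$ is the permutation matrix whose entries equal to $1$ are $P_{m+1-j,\,2j-1}=1$ and $P_{m+j,\,2j}=1$ for $j=1,\dots,m$, and $Q$ is the block diagonal matrix $$Q=\bigoplus_{j=1}^m \begin{pmatrix}0&a_{2j-1}\\ a_{2j}&0\end{pmatrix},$$ so that $P$ is an even permutation matrix, thus is special orthogonal. For $n=2m+1$ odd, $P$ is the permutation matrix whose entries equal to $1$ are $P_{m+1,1}=1$, $P_{m+1-j,\,2j}=1$ and $P_{m+1+j,\,2j+1}=1$ for $j=1,\dots,m$, and $$Q=(a_1)\oplus\bigoplus_{j=1}^m \begin{pmatrix}0&a_{2j+1}\\ a_{2j}&0\end{pmatrix},$$ so that $P$ is an odd permutation matrix. (b) Let $\hat{\mathcal T}$ be the set of transpose pairs $\tau=\{\tau_1,\tau_2\}$ on the antidiagonal of $A$, and, if $n$ is odd, let $c$ be the center element of $A$. Then $A$ is permutation-similar to $\mathfrak Q$, where $$\mathfrak Q=\bigoplus_{\tau\in\hat{\mathcal T}}\begin{pmatrix}0&\tau_1\\ \tau_2&0\end{pmatrix}\ \ (n\text{ even}),\qquad \mathfrak Q=\bigoplus_{\tau\in\hat{\mathcal T}\setminus\{c,c\}}\begin{pmatrix}0&\tau_1\\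 \tau_2&0\end{pmatrix}\oplus c\,(1)\ \ (n\text{ odd}),$$ where $(1)$ is the identity matrix of size $1$ and $\hat{\mathcal T}\setminus\{c,c\}$ denotes the transpose pairs other than the one consisting of the center element.
   Context: An antidiagonal matrix is a square matrix whose only nonzero entries lie on the antidiagonal (positions $(i,n+1-i)$). Standard form: for $n=2m$ the antidiagonal entries of $A$ are labelled $A_{m+1-j,\,m+j}=a_{2j-1}$, $A_{m+j,\,m+1-j}=a_{2j}$ ($1\le j\le m$); for $n=2m+1$ they are labelled $A_{m+1,m+1}=a_1$, $A_{m+1-j,\,m+1+j}=a_{2j+1}$, $A_{m+1+j,\,m+1-j}=a_{2j}$ ($1\le j\le m$). Two matrices $M,N$ are permutation-similar if $M=VNV^{-1}$ for a permutation matrix $V$. A permutation matrix is even or odd according to the parity of the corresponding permutation. A matrix is hollow if its main diagonal is zero, pseudo-hollow if at most one entry of its main diagonal is nonzero, and quasidiagonal if it is block diagonal with square diagonal blocks of size at most $2$. A transpose pair of a matrix is a pair of indexed entries that are reflections of each other across the main diagonal (an entry on the main diagonal is paired with itself).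
   Formalization: For n = 2m+1 the claim that P is an odd permutation matrix is false when m is even (n = 5: rows 3,2,4,1,5 have 4 inversions); the formal statement says instead that P is odd if m is odd and even if m is even. *)

(* Defs.v *)
From HB Require Import structures.
From mathcomp Require Import all_boot all_order all_fingroup all_algebra.
From mathcomp Require Export complex.
From mathcomp Require Export reals.

Set Implicit Arguments.
Unset Strict Implicit.
Unset Printing Implicit Defensive.

Import Order.TTheory GRing.Theory Num.Theory.
Local Open Scope ring_scope.

Section Notions.
Variable F : fieldType.

(* [rev_ord i] is the 0-based form of the 1-based map i |-> n + 1 - i. *)
Definition antidiagonal_mx n (A : 'M[F]_n) : Prop :=
  forall i k : 'I_n, k != rev_ord i -> A i k = 0.

Definition hollow n (M : 'M[F]_n) : Prop := forall i, M i i = 0.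

Definition pseudo_hollow n (M : 'M[F]_n) : Prop :=
  (#|[set i | M i i != 0%R]| <= 1)%N.

Definition quasidiagonal n (M : 'M[F]_n) : Prop :=
  exists (k : nat) (p : 'I_k -> nat) (B : forall i, 'M[F]_(p i))
         (e : (\sum_i p i)%N = n),
    (forall i, 0 < p i <= 2)%N /\ M = castmx (e, e) (\mxdiag_i B i).

(* M = V N V^-1.  The sizes of M and N are only required to be provably equal,
   so that N may be a direct sum, whose size is a sum of block sizes. *)
Definition conjugate_by n k (V : 'M[F]_n) (M : 'M[F]_n) (N : 'M[F]_k) : Prop :=
  exists e : k = n, M = V *m castmx (e, e) N *m invmx V.

Definition perm_similar n k (M : 'M[F]_n) (N : 'M[F]_k) : Prop :=
  exists V : 'M[F]_n, is_perm_mx V /\ conjugate_by V M N.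

Definition even_perm_mx n (V : 'M[F]_n) : Prop :=
  exists s : 'S_n, V = perm_mx s /\ ~~ odd_perm s.

Definition odd_perm_mx n (V : 'M[F]_n) : Prop :=
  exists s : 'S_n, V = perm_mx s /\ odd_perm s.

Definition antidiag2 (x y : F) : 'M[F]_2 :=
  block_mx (0 : 'M_1) x%:M y%:M (0 : 'M_1).

(* The 0/1 matrix whose entries equal to 1 are at the listed 1-based positions;
   listed positions outside the matrix are ignored. *)
Definition ones_at n (s : seq (nat * nat)) : 'M[F]_n :=
  \matrix_(i, k) ((i.+1, k.+1) \in s)%:R.

(* Below, entries a_1, ..., a_n are given by a : nat -> F; the values of a
   outside 1, ..., n are irrelevant. *)

Definition standard_form_even n (m : nat) (A : 'M[F]_n) (a : nat -> F) : Prop :=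
  forall (j : nat) (i k : 'I_n), (1 <= j <= m)%N ->
    i.+1 = (m + 1 - j)%N -> k.+1 = (m + j)%N ->
    A i k = a (2 * j - 1)%N /\ A k i = a (2 * j)%N.

Definition standard_form_odd n (m : nat) (A : 'M[F]_n) (a : nat -> F) : Prop :=
  (forall i : 'I_n, i.+1 = (m + 1)%N -> A i i = a 1%N) /\
  (forall (j : nat) (i k : 'I_n), (1 <= j <= m)%N ->
    i.+1 = (m + 1 - j)%N -> k.+1 = (m + 1 + j)%N ->
    A i k = a (2 * j + 1)%N /\ A k i = a (2 * j)%N).

Definition P_even n (m : nat) : 'M[F]_n :=
  ones_at n (flatten [seq [:: ((m + 1 - j)%N, (2 * j - 1)%N);
                              ((m + j)%N, (2 * j)%N)] | j <- iota 1 m]).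

(* The column-to-row permutation lists rows m+1, m, m+2, m-1, m+3, ...; it has
   1 + 3 + ... + (2m - 1) = m^2 inversions, so it is odd exactly when m is. *)
Definition P_odd n (m : nat) : 'M[F]_n :=
  ones_at n (((m + 1)%N, 1%N) ::
             flatten [seq [:: ((m + 1 - j)%N, (2 * j)%N);
                              ((m + 1 + j)%N, (2 * j + 1)%N)] | j <- iota 1 m]).

(* The ordinal j : 'I_m stands for the 1-based index j.+1. *)
Definition Q_even (m : nat) (a : nat -> F) : 'M[F]_(\sum_(j < m) 2) :=
  \mxdiag_(j < m) antidiag2 (a (2 * j.+1 - 1)%N) (a (2 * j.+1)%N).

Definition Q_odd (m : nat) (a : nat -> F) : 'M[F]_(1 + \sum_(j < m) 2) :=
  block_mx (a 1%N)%:M 0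
           0 (\mxdiag_(j < m) antidiag2 (a (2 * j.+1 + 1)%N) (a (2 * j.+1)%N)).

End Notions.

Definition special_orthogonal (C : numFieldType) n (M : 'M[C]_n) : Prop :=
  [/\ M \is a mxOver Num.real, M *m M^T = 1%:M & \det M = 1].

(* Indexed entries are identified with their positions, so that equal values at
   different positions remain distinct. *)

Definition antidiagonal_positions n : {set 'I_n * 'I_n} :=
  [set p | p.2 == rev_ord p.1].

Definition transpose_pairs n : {set {set 'I_n * 'I_n}} :=
  [set [set p; (p.2, p.1)] | p : 'I_n * 'I_n].

Definition antidiagonal_transpose_pairs n : {set {set 'I_n * 'I_n}} :=
  [set tau in transpose_pairs n | tau \subset antidiagonal_positions n].

(* The summands are taken in the order of r; t1 tau and t2 tau label the two
   members of the (unordered) pair tau. *)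
Definition pair_sum (F : fieldType) n (A : 'M[F]_n)
    (r : seq {set 'I_n * 'I_n}) (t1 t2 : {set 'I_n * 'I_n} -> 'I_n * 'I_n) :
    'M[F]_(\sum_(j < size r) 2) :=
  \mxdiag_(j < size r)
    (let tau := tnth (in_tuple r) j in
     antidiag2 (A (t1 tau).1 (t1 tau).2) (A (t2 tau).1 (t2 tau).2)).

(* Main.v *)
Require Import Defs.
From HB Require Import structures.
From mathcomp Require Import all_boot all_order all_fingroup all_algebra.
From mathcomp Require Import complex reals.
From mathcomp Require Import zify.

Set Implicit Arguments.
Unset Strict Implicit.
Unset Printing Implicit Defensive.

Import Order.TTheory GRing.Theory Num.Theory.
Local Open Scope ring_scope.

(* Row i of an antidiagonal matrix has its only possible nonzero entry in column
   rev_ord i, so listing the indices in mirror pairs h, rev_ord h (with the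
   fixed centre first or last when n is odd) conjugates A to a direct sum of
   2 x 2 antidiagonal blocks. For the explicit P the listing zigzags outwards
   from the centre; passing from n to n + 2 inserts a new smallest and a new
   largest row, which changes the parity of the permutation exactly when n is
   odd. *)

(** * Conjugation by a permutation matrix as reindexing *)

(** [perm_mx s] has its ones at the positions [(i, s i)], so [perm_mx s^-1] has them at [(s k, k)]:
    here [s] is the column-to-row map, and conjugation moves the entry at [(u, v)] to
    [(s u, s v)]. *)
Lemma conjugate_by_perm (F : fieldType) n k (A : 'M[F]_n) (N : 'M[F]_k)
    (e : k = n) (s : 'S_n) :
  (forall u v, A (s (cast_ord e u)) (s (cast_ord e v)) = N u v) ->
  conjugate_by (perm_mx s^-1) A N.
Proof.
case: n / e A s => A s AN; exists erefl; rewrite castmx_id.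
have -> : invmx (perm_mx s^-1) = perm_mx s^-1^-1 :> 'M[F]_k.
  apply: (can_inj (mulKmx (unitmx_perm F s^-1))).
  by rewrite mulmxV ?unitmx_perm// -perm_mxM mulgV perm_mx1.
rewrite -row_permE -col_permE; apply/matrixP => i j.
by rewrite !mxE -AN !cast_ord_id !permKV.
Qed.

(** Serves where no explicit permutation matrix is prescribed: the bijection also yields the
    equality of the sizes, by counting. *)
Lemma perm_similar_bij (F : fieldType) n k (A : 'M[F]_n) (N : 'M[F]_k)
    (g : 'I_k -> 'I_n) :
  bijective g -> (forall u v, A (g u) (g v) = N u v) -> perm_similar A N.
Proof.
move=> g_bij AN.
have e : k = n by have := bij_eq_card g_bij; rewrite !card_ord.
have s_inj : injective (g \o cast_ord (esym e)).
  by move=> u v /(bij_inj g_bij)/cast_ord_inj.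
exists (perm_mx (perm s_inj)^-1); split; first exact: perm_mx_is_perm.
apply: (conjugate_by_perm (e := e)) => u v.
by rewrite !permE /= !cast_ordK.
Qed.

Lemma codom_bij (T T' : finType) (f : T -> T') :
  injective f -> (forall y, y \in codom f) -> bijective f.
Proof.
move=> f_inj f_surj; apply: inj_card_bij => //.
rewrite -(card_codom f_inj) subset_leq_card //; apply/subsetP => y _.
exact: f_surj.
Qed.

(** * Entries of a direct sum of antidiagonal blocks of size 2 *)

Lemma antidiag2E (F : fieldType) (x y : F) (i j : 'I_2) :
  antidiag2 x y i j =
  if i == j :> nat then 0 else if i == 0 :> nat then x else y.
Proof.
rewrite /antidiag2 mxE; case: splitP => i' ->; rewrite mxE;
  by case: splitP => j' ->; rewrite !ord1 !mxE.
Qed.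

(** With all blocks of size 2, the block number and the offset in the block become the half and the
    parity of the global index, so that block bookkeeping turns into arithmetic. *)
Lemma Rank_pair_val m (j : 'I_m) (b : 'I_2) :
  tagnat.Rank (p_ := fun=> 2%N) j b = (2 * j + b)%N :> nat.
Proof.
rewrite tagnat.RankEsum (big_ord_narrow (ltnW (ltn_ord j))).
by rewrite sum_nat_const card_ord mulnC.
Qed.

Lemma sig1_pair_val m (u : 'I_(\sum_(j < m) 2)) :
  tagnat.sig1 u = u./2 :> nat.
Proof.
rewrite -[in RHS](tagnat.sig2K u) Rank_pair_val.
by case: (tagnat.sig2 u) => b /=; lia.
Qed.

Lemma sig2_pair_val m (u : 'I_(\sum_(j < m) 2)) :
  tagnat.sig2 u = odd u :> nat.
Proof.
rewrite -[in RHS](tagnat.sig2K u) Rank_pair_val.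
by case: (tagnat.sig2 u) => b /=; lia.
Qed.

Lemma mxdiag_antidiag2E (F : fieldType) m (x y : 'I_m -> F)
    (u v : 'I_(\sum_(j < m) 2)) :
  (\mxdiag_(j < m) antidiag2 (x j) (y j)) u v =
  if (tagnat.sig1 u == tagnat.sig1 v) && (odd u != odd v)
  then (if odd u then y else x) (tagnat.sig1 u) else 0.
Proof.
rewrite mxE; case: eqVneq => [_|] /=; last by rewrite mxE.
rewrite conform_mx_id antidiag2E !sig2_pair_val.
by case: (odd u); case: (odd v).
Qed.

(** * Listing indices by mirror pairs *)

Definition pair_index n m (h : 'I_m -> 'I_n) (u : 'I_(\sum_(j < m) 2)) : 'I_n :=
  if odd u then rev_ord (h (tagnat.sig1 u)) else h (tagnat.sig1 u).

(** Here [h] picks one representative per mirror pair. The second hypothesis puts equal values in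
    the same block; inside a block, different parities would make a representative its own mirror
    image. *)
Lemma pair_index_inj n m (h : 'I_m -> 'I_n) :
  (forall i, h i != rev_ord (h i)) ->
  (forall i j, h i = h j \/ h i = rev_ord (h j) -> i = j) ->
  injective (pair_index h).
Proof.
move=> h_nfix h_inj u v; rewrite /pair_index => uv.
have e1 : tagnat.sig1 u = tagnat.sig1 v.
  apply: h_inj; move: uv; case: ifP => _; case: ifP => _; last by left.
  - by move/rev_ord_inj; left.
  - by move=> <-; rewrite rev_ordK; right.
  - by right.
have uv2 : u./2 = v./2 by rewrite -!sig1_pair_val e1.
apply: ord_inj; rewrite -(odd_double_half u) -(odd_double_half v) uv2.
have := h_nfix (tagnat.sig1 v); move: uv; rewrite e1.
case: (odd u); case: (odd v) => //.
- by move=> ->; rewrite eqxx.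
- by move=> <-; rewrite eqxx.
Qed.

(** The only column that can be nonzero in row [pair_index h u] is its mirror image, which the
    listing holds at the other position of the block of [u]; injectivity rules out any other [v]. *)
Lemma antidiagonal_pairs (F : fieldType) n (A : 'M[F]_n) m (h : 'I_m -> 'I_n) :
  antidiagonal_mx A -> injective (pair_index h) ->
  forall u v, A (pair_index h u) (pair_index h v) =
    (\mxdiag_(j < m) antidiag2 (A (h j) (rev_ord (h j)))
                               (A (rev_ord (h j)) (h j))) u v.
Proof.
move=> hA h_inj u v; rewrite mxdiag_antidiag2E.
case: ifPn => [/andP[/eqP e1 ne2]|nuv].
  by rewrite /pair_index -e1; case: (odd u) ne2; case: (odd v).
apply: hA; apply: contraNneq nuv => vu.
(* [b] is the offset that [u] does not occupy in its block. *)
pose b : 'I_2 := inord (~~ odd u).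
have bE : b = ~~ odd u :> nat by rewrite inordK //; case: (odd u).
have -> : v = tagnat.Rank (p_ := fun=> 2%N) (tagnat.sig1 u) b.
  apply: h_inj; rewrite vu /pair_index tagnat.Rank1K Rank_pair_val bE.
  by rewrite oddD oddM /=; case: (odd u); rewrite ?rev_ordK.
rewrite tagnat.Rank1K eqxx Rank_pair_val bE oddD oddM /=.
by case: (odd u).
Qed.

(** * The zigzag permutation, its parity, and the explicit [P] *)

(* 0-based form of the listing m, m+1, m-1, m+2, ... of the rows when n = 2m,
   and m+1, m, m+2, m-1, ... when n = 2m+1. *)
Definition zigzag n k : nat :=
  if odd n (+) odd k then (n./2 + k./2)%N else (n./2 - k./2.+1)%N.

Lemma zigzag_perm n :
  exists s : 'S_n,
    (forall k, s k = zigzag n k :> nat) /\ odd_perm s = odd n && odd n./2.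
Proof.
(* Two consecutive sizes are carried along, since the recursion goes from [n] to [n + 2]. *)
suff [] : (exists s : 'S_n,
    (forall k, s k = zigzag n k :> nat) /\ odd_perm s = odd n && odd n./2) /\
  (exists s : 'S_n.+1, (forall k, s k = zigzag n.+1 k :> nat) /\
    odd_perm s = odd n.+1 && odd n.+1./2) by [].
elim: n => [|n [[s [sE s_odd]] IH]].
  split; first by exists 1%g; split=> [[]//|]; rewrite odd_perm1.
  by exists 1%g; split=> [k|]; rewrite ?odd_perm1 // perm1 ord1.
split=> //.
(* The last column takes the largest row, the one before it the smallest, and all older rows move up
   by one. The inner lift changes the parity by [odd n], the outer one not at all. *)
exists (lift_perm ord_max ord_max (lift_perm ord_max ord0 s)); split=> [k|].
  case: (unliftP ord_max k) => [k'|] ->; last first.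
    by rewrite lift_perm_id /= /zigzag; case: ifP; lia.
  rewrite lift_perm_lift !lift_max.
  case: (unliftP ord_max k') => [k''|] ->; last first.
    by rewrite lift_perm_id /= /zigzag; case: ifP; lia.
  have lt_k : (k'' < n)%N := ltn_ord k''.
  rewrite lift_perm_lift lift_max lift0 sE /zigzag.
  by move: (nat_of_ord k'') lt_k => j lt_j; do 2!case: ifP; lia.
by rewrite !odd_lift_perm s_odd /=; lia.
Qed.

Lemma P_evenE (F : fieldType) n m (s : 'S_n) :
  n = (2 * m)%N -> (forall k, s k = zigzag n k :> nat) ->
  P_even F n m = perm_mx s^-1.
Proof.
move=> nE sE; apply/matrixP => i k; rewrite !mxE; congr (_%:R).
have lt_k := ltn_ord k.
have -> : (s^-1%g i == k) = (i == zigzag n k :> nat).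
  by rewrite -sE val_eqE -(inj_eq (@perm_inj _ s)) permKV.
congr nat_of_bool; apply/flatten_mapP/eqP => [[j]|iE].
  rewrite mem_iota !inE !xpair_eqE /zigzag; case: ifP; lia.
(* The 1-based pair [j] occupies the 0-based columns [2j - 2] and [2j - 1]. *)
exists (k./2.+1); first by rewrite mem_iota; lia.
by rewrite !inE !xpair_eqE; move: iE; rewrite /zigzag; case: ifP; lia.
Qed.

Lemma P_oddE (F : fieldType) n m (s : 'S_n) :
  n = (2 * m + 1)%N -> (forall k, s k = zigzag n k :> nat) ->
  P_odd F n m = perm_mx s^-1.
Proof.
move=> nE sE; apply/matrixP => i k; rewrite !mxE; congr (_%:R).
have lt_k := ltn_ord k.
have -> : (s^-1%g i == k) = (i == zigzag n k :> nat).
  by rewrite -sE val_eqE -(inj_eq (@perm_inj _ s)) permKV.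
congr nat_of_bool; rewrite in_cons; apply/orP/eqP => [[|/flatten_mapP[j]]|iE].
- by rewrite xpair_eqE /zigzag; case: ifP; lia.
- rewrite mem_iota !inE !xpair_eqE /zigzag; case: ifP; lia.
have [k0|k_gt0] := posnP k.
  by left; rewrite xpair_eqE; move: iE; rewrite /zigzag; case: ifP; lia.
right; apply/flatten_mapP.
(* Column 0 belongs to the centre, so pair [j] now occupies the 0-based columns [2j - 1] and
   [2j]. *)
exists (uphalf k); first by rewrite mem_iota; lia.
by rewrite !inE !xpair_eqE; move: iE; rewrite /zigzag; case: ifP; lia.
Qed.

(** * Conjugation of the standard form by the explicit [P] *)

Lemma conjugate_by_P_even (F : fieldType) n (A : 'M[F]_n) m a (s : 'S_n) :
  antidiagonal_mx A -> n = (2 * m)%N -> standard_form_even m A a ->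
  (forall k, s k = zigzag n k :> nat) ->
  conjugate_by (perm_mx s^-1) A (Q_even m a).
Proof.
move=> hA nE Aa sE.
have e : (\sum_(j < m) 2)%N = n by rewrite sum_nat_const card_ord mulnC.
(* The representative of a block is its first listed row, which lies in the upper half; with this
   choice the zigzag is the listing by mirror pairs. *)
pose h (j : 'I_m) := s (cast_ord e (tagnat.Rank j ord0)).
have hE (j : 'I_m) : h j = (m - j.+1)%N :> nat.
  have lt_j := ltn_ord j.
  by rewrite sE [val _]Rank_pair_val /= /zigzag; case: ifP; lia.
have pairE u : pair_index h u = s (cast_ord e u).
  apply: ord_inj; rewrite /pair_index sE /zigzag /=.
  have := ltn_ord (tagnat.sig1 u).
  by do 2![case: ifP => ?]; rewrite /= hE sig1_pair_val; lia.
apply: (conjugate_by_perm (e := e)) => u v; rewrite -!pairE.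
rewrite antidiagonal_pairs //; last first.
  by move=> x y; rewrite !pairE => /perm_inj/cast_ord_inj.
rewrite !mxdiag_antidiag2E; case: ifP => // _.
set j := tagnat.sig1 u; have lt_j := ltn_ord j.
have [|||A1 A2] := Aa j.+1 (h j) (rev_ord (h j)); rewrite /= ?hE; try lia.
by case: (odd u); rewrite /= (A1, A2).
Qed.

Lemma conjugate_by_P_odd (F : fieldType) n (A : 'M[F]_n) m a (s : 'S_n) :
  antidiagonal_mx A -> n = (2 * m + 1)%N -> standard_form_odd m A a ->
  (forall k, s k = zigzag n k :> nat) ->
  conjugate_by (perm_mx s^-1) A (Q_odd m a).
Proof.
move=> hA nE [Aa1 Aa] sE.
have e : (1 + \sum_(j < m) 2)%N = n by rewrite sum_nat_const card_ord; lia.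
pose c := s (cast_ord e (lshift _ ord0)).
have cE : c = m :> nat by rewrite sE /zigzag /=; case: ifP; lia.
pose h (j : 'I_m) := s (cast_ord e (rshift 1 (tagnat.Rank j ord0))).
have hE (j : 'I_m) : h j = (m - j.+1)%N :> nat.
  have lt_j := ltn_ord j.
  rewrite sE [val _](congr1 S (Rank_pair_val j ord0)) /= /zigzag.
  by case: ifP; lia.
(* Past the centre, the zigzag of odd size is again a listing by mirror pairs, shifted by one
   position. *)
have pairE u : s (cast_ord e (rshift 1 u)) = pair_index h u.
  apply: ord_inj; rewrite /pair_index sE /zigzag /=.
  have := ltn_ord (tagnat.sig1 u).
  by do 2![case: ifP => ?]; rewrite /= hE sig1_pair_val add0n uphalf_half; lia.
have h_inj : injective (pair_index h).
  by move=> x y; rewrite -!pairE => /perm_inj/cast_ord_inj/rshift_inj.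
have c_out u : pair_index h u != c.
  by rewrite -pairE (inj_eq perm_inj) (inj_eq (@cast_ord_inj _ _ e)) eq_rlshift.
have rev_c : rev_ord c = c by apply: ord_inj; rewrite /= cE; lia.
apply: (conjugate_by_perm (e := e)) => u v.
(* The off-diagonal blocks vanish because the centre is its own mirror image and occurs in no listed
   pair. *)
rewrite -(splitK u) -(splitK v).
case: (split u) => u'; case: (split v) => v' /=.
- by rewrite block_mxEul !ord1 mxE Aa1 // -/c cE addn1.
- rewrite block_mxEur !ord1 mxE -/c pairE; apply: hA.
  by rewrite rev_c.
- rewrite block_mxEdl !ord1 mxE -/c pairE; apply: hA.
  by rewrite -{1}rev_c (inj_eq rev_ord_inj) eq_sym.
rewrite block_mxEdr !pairE antidiagonal_pairs //.
rewrite !mxdiag_antidiag2E; case: ifP => // _.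
set j := tagnat.sig1 _; have lt_j := ltn_ord j.
have [|||A1 A2] := Aa j.+1 (h j) (rev_ord (h j)); rewrite /= ?hE; try lia.
by case: (odd u'); rewrite /= (A1, A2).
Qed.

(** * Transpose pairs on the antidiagonal *)

Definition mirror_pair {n} (i : 'I_n) : {set 'I_n * 'I_n} :=
  [set (i, rev_ord i); (rev_ord i, i)].

Lemma mirror_pair_rev n (i : 'I_n) : mirror_pair (rev_ord i) = mirror_pair i.
Proof. by rewrite /mirror_pair rev_ordK setUC. Qed.

Lemma mirror_pair_eq n (i j : 'I_n) :
  mirror_pair i = mirror_pair j -> i = j \/ i = rev_ord j.
Proof.
move=> ij; have : (i, rev_ord i) \in mirror_pair j by rewrite -ij !inE eqxx.
by rewrite !inE !xpair_eqE => /orP[] /andP[/eqP -> _]; [left | right].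
Qed.

(** A position on the antidiagonal is determined by its row, and its transpose is again on the
    antidiagonal because [rev_ord] is an involution; pairs can thus be handled through row
    indices. *)
Lemma antidiagonal_transpose_pairsE n :
  antidiagonal_transpose_pairs n = mirror_pair @: [set: 'I_n].
Proof.
apply/setP => tau; rewrite inE; apply/andP/imsetP => [[]|[i _ ->]].
  case/imsetP => -[i k] _ -> /subsetP /(_ (i, k)).
  rewrite !inE eqxx => /(_ isT) /eqP /= ->.
  by exists i; rewrite ?inE.
split; first by apply/imsetP; exists (i, rev_ord i).
by apply/subsetP => p; rewrite !inE => /orP[] /eqP -> //=; rewrite rev_ordK.
Qed.

(** Both members of the pair must occur among the labels, so [p] and [q] are these members in one
    order or the other. The row of [p] can then represent the pair, whichever labelling was
    chosen. *)
Lemma mirror_pair_labels n (i : 'I_n) p q :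
  mirror_pair i = [set p; q] ->
  [/\ mirror_pair i = mirror_pair p.1, p = (p.1, rev_ord p.1)
    & q = (rev_ord p.1, p.1)].
Proof.
move=> ipq.
have : p \in mirror_pair i by rewrite ipq !inE eqxx.
have : q \in mirror_pair i by rewrite ipq !inE eqxx orbT.
have : (i, rev_ord i) \in [set p; q] by rewrite -ipq !inE eqxx.
have : (rev_ord i, i) \in [set p; q] by rewrite -ipq !inE eqxx orbT.
rewrite !inE => ri_pq i_pq /pred2P q_i /pred2P[] p_i; move: q_i ri_pq i_pq;
  rewrite {}p_i /= ?rev_ordK ?mirror_pair_rev.
- case=> -> // /orP[] /eqP e _; split=> //; exact: esym e.
- case=> -> // _ /orP[] /eqP e; split=> //; exact: esym e.
Qed.

(** [D] is the set of rows to be listed: all of them for even size, all but the centre for odd size.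
    The row of the first label represents each pair; as [r] has no repetition, distinct blocks hold
    distinct pairs. *)
Lemma pair_sum_index (F : fieldType) n (A : 'M[F]_n) r t1 t2 (D : {set 'I_n}) :
  (forall i, i \in D -> rev_ord i \in D) ->
  (forall i, i \in D -> i != rev_ord i) ->
  perm_eq r (enum (mirror_pair @: D)) ->
  (forall tau, tau \in r -> tau = [set t1 tau; t2 tau]) ->
  exists h : 'I_(size r) -> 'I_n,
    [/\ injective (pair_index h), codom (pair_index h) =i D
      & pair_sum A r t1 t2 =
        \mxdiag_(j < size r) antidiag2 (A (h j) (rev_ord (h j)))
                                       (A (rev_ord (h j)) (h j))].
Proof.
move=> D_rev D_nfix rD r_lab; pose tau j := tnth (in_tuple r) j.
have mem_r t : (t \in r) = (t \in mirror_pair @: D).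
  by rewrite (perm_mem rD) mem_enum.
have tau_r j : tau j \in r by apply: (mem_tnth j (in_tuple r)).
pose h j := (t1 (tau j)).1.
have hP j : [/\ h j \in D, tau j = mirror_pair (h j),
                t1 (tau j) = (h j, rev_ord (h j))
              & t2 (tau j) = (rev_ord (h j), h j)].
  have := tau_r j; rewrite mem_r => /imsetP[i iD tau_i].
  have := r_lab _ (tau_r j); rewrite [LHS]tau_i => /mirror_pair_labels[e -> ->].
  rewrite -/(h j) in e *; split=> //; last by rewrite tau_i.
  case: (mirror_pair_eq e) => [<- //|ei].
  by rewrite -(rev_ordK (h j)) -ei; apply: D_rev.
have h_inj i j : h i = h j \/ h i = rev_ord (h j) -> i = j.
  have r_uniq : uniq (in_tuple r) by rewrite /= (perm_uniq rD) enum_uniq.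
  move=> hij; apply: (tuple_uniqP _ r_uniq); rewrite -/(tau i) -/(tau j).
  have [_ -> _ _] := hP i; have [_ -> _ _] := hP j.
  by case: hij => ->; rewrite ?mirror_pair_rev.
exists h; split.
- by apply: pair_index_inj => // i; apply: D_nfix; case: (hP i).
- move=> i; apply/codomP/idP => [[u ->]|iD].
    have [hD _ _ _] := hP (tagnat.sig1 u).
    by rewrite /pair_index; case: ifP => // _; apply: D_rev.
  have /tnthP[j tau_j] : mirror_pair i \in in_tuple r.
    by rewrite /= mem_r imset_f.
  (* A row of [D] is the representative of its pair, found at offset 0, or the mirror image of it,
     found at offset 1. *)
  have [_ + _ _] := hP j; rewrite -[LHS]tau_j => /mirror_pair_eq[] ->.
    exists (tagnat.Rank (p_ := fun=> 2%N) j ord0).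
    by rewrite /pair_index Rank_pair_val tagnat.Rank1K oddD oddM.
  exists (tagnat.Rank (p_ := fun=> 2%N) j ord_max).
  by rewrite /pair_index Rank_pair_val tagnat.Rank1K oddD oddM.
have -> : pair_sum A r t1 t2 = \mxdiag_(j < size r)
    antidiag2 (A (t1 (tau j)).1 (t1 (tau j)).2)
              (A (t2 (tau j)).1 (t2 (tau j)).2).
  by [].
apply/matrixP => u v; rewrite !mxdiag_antidiag2E.
have [_ _ t1E t2E] := hP (tagnat.sig1 u).
by case: (odd u); rewrite /= (t1E, t2E).
Qed.

(** * Similarity to the direct sum over transpose pairs *)

Lemma perm_similar_pair_sum_even (F : fieldType) n (A : 'M[F]_n) r t1 t2 :
  antidiagonal_mx A -> ~~ odd n ->
  perm_eq r (enum (antidiagonal_transpose_pairs n)) ->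
  (forall tau, tau \in r -> tau = [set t1 tau; t2 tau]) ->
  perm_similar A (pair_sum A r t1 t2).
Proof.
move=> hA n_even; rewrite antidiagonal_transpose_pairsE => rE r_lab.
have nfix (i : 'I_n) : i \in [set: 'I_n] -> i != rev_ord i.
  move=> _; apply/eqP => /(congr1 val) /=; have := ltn_ord i; lia.
have stable (i : 'I_n) : i \in [set: 'I_n] -> rev_ord i \in [set: 'I_n].
  by rewrite !inE.
have [h [h_inj h_codom ->]] := pair_sum_index A stable nfix rE r_lab.
apply: (perm_similar_bij (g := pair_index h)).
  by apply: codom_bij => // i; rewrite h_codom inE.
exact: antidiagonal_pairs.
Qed.

(** The equation [n = 2 * c + 1] makes [c] the only fixed point of [rev_ord]. The other rows are
    listed by mirror pairs and [c] is put last. *)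
Lemma perm_similar_pair_sum_odd (F : fieldType) n (A : 'M[F]_n) (c : 'I_n)
    r t1 t2 :
  antidiagonal_mx A -> n = (2 * c + 1)%N ->
  perm_eq r (enum (antidiagonal_transpose_pairs n :\ [set (c, c); (c, c)])) ->
  (forall tau, tau \in r -> tau = [set t1 tau; t2 tau]) ->
  perm_similar A
    (block_mx (pair_sum A r t1 t2) 0 0 (A c c *: (1%:M : 'M[F]_1))).
Proof.
move=> hA nE rE r_lab.
have fixE (i : 'I_n) : (i == rev_ord i) = (i == c).
  by rewrite -!val_eqE /=; have := ltn_ord i; lia.
have rev_c : rev_ord c = c by apply/esym/eqP; rewrite fixE.
have D_rev i : i \in [set~ c] -> rev_ord i \in [set~ c].
  by rewrite !inE; apply: contraNneq => ic; rewrite -(rev_ordK i) ic rev_c.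
have D_nfix i : i \in [set~ c] -> i != rev_ord i by rewrite !inE fixE.
(* The removed set is the mirror pair of [c], and no other row has the same mirror pair. *)
have pairsE : antidiagonal_transpose_pairs n :\ [set (c, c); (c, c)] =
              mirror_pair @: [set~ c].
  have -> : [set (c, c); (c, c)] = mirror_pair c by rewrite /mirror_pair rev_c.
  rewrite antidiagonal_transpose_pairsE; apply/setP => t; rewrite !inE.
  apply/andP/imsetP => [[ne_c /imsetP[i _ tE]]|[j]].
    exists i => //; move: ne_c; rewrite tE !inE.
    by apply: contraNneq => ->.
  rewrite !inE => jc ->; rewrite imset_f ?inE //; split=> //.
  by apply: contraNneq jc => /mirror_pair_eq[] ->; rewrite ?rev_c.
rewrite pairsE in rE.
have [h [h_inj h_codom ->]] := pair_sum_index A D_rev D_nfix rE r_lab.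
have h_c u : pair_index h u != c.
  by have := codom_f (pair_index h) u; rewrite h_codom !inE.
pose g (u : 'I_(\sum_(j < size r) 2 + 1)) : 'I_n :=
  match split u with inl u' => pair_index h u' | inr _ => c end.
have gl u : g (lshift 1 u) = pair_index h u.
  by rewrite /g (unsplitK (inl u)).
have gr u : g (rshift (\sum_(j < size r) 2) u) = c.
  by rewrite /g (unsplitK (inr u)).
apply: (perm_similar_bij (g := g)).
  apply: codom_bij => [u v|i].
    rewrite -(splitK u) -(splitK v).
    case: (split u) => u'; case: (split v) => v' /=; rewrite ?gl ?gr.
    - by move/h_inj ->.
    - by move/eqP; rewrite (negPf (h_c _)).
    - by move/esym/eqP; rewrite (negPf (h_c _)).
    - by rewrite !ord1.
  apply/codomP; have [->|ic] := eqVneq i c.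
    by exists (rshift _ ord0); rewrite gr.
  have /codomP[u ->] : i \in codom (pair_index h) by rewrite h_codom !inE.
  by exists (lshift 1 u); rewrite gl.
move=> u v; rewrite -(splitK u) -(splitK v).
case: (split u) => u'; case: (split v) => v' /=; rewrite ?gl ?gr.
- by rewrite block_mxEul antidiagonal_pairs.
- rewrite block_mxEur mxE; apply: hA.
  by rewrite -{1}rev_c (inj_eq rev_ord_inj) eq_sym.
- by rewrite block_mxEdl mxE; apply: hA; rewrite rev_c.
- by rewrite block_mxEdr !ord1 !mxE mulr1.
Qed.

(** * Shape of the direct sums [Q_even] and [Q_odd] *)

Lemma hollow_Q_even (F : fieldType) n m (a : nat -> F) e :
  hollow (castmx (e, e) (Q_even m a) : 'M[F]_n).
Proof.
by case: n / e => i; rewrite castmx_id mxdiag_antidiag2E !eqxx.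
Qed.

Lemma quasidiagonal_Q_even (F : fieldType) n m (a : nat -> F) e :
  quasidiagonal (castmx (e, e) (Q_even m a) : 'M[F]_n).
Proof.
by exists m, (fun=> 2%N),
  (fun j : 'I_m => antidiag2 (a (2 * j.+1 - 1)%N) (a (2 * j.+1)%N)), e.
Qed.

Lemma pseudo_hollow_Q_odd (F : fieldType) n m (a : nat -> F) e :
  pseudo_hollow (castmx (e, e) (Q_odd m a) : 'M[F]_n).
Proof.
case: n / e; rewrite castmx_id.
suff only0 i : Q_odd m a i i != 0 -> i = lshift _ ord0.
  by apply/card_le1_eqP => i j; rewrite !inE => /only0 -> /only0 ->.
rewrite -(splitK i); case: (split i) => i' /=; first by rewrite ord1.
by rewrite block_mxEdr mxdiag_antidiag2E !eqxx.
Qed.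

Lemma quasidiagonal_Q_odd (F : fieldType) n m (a : nat -> F) e :
  quasidiagonal (castmx (e, e) (Q_odd m a) : 'M[F]_n).
Proof.
(* Both p and B compute on successors, so that dropping the first block of
   mxdiag B yields the tail of Q_odd by conversion. *)
pose p (k : nat) := if k is 0 then 1%N else 2%N.
pose B k : 'M[F]_(p k) :=
  match k with
  | 0 => (a 1%N)%:M
  | j.+1 => antidiag2 (a (2 * j.+1 + 1)%N) (a (2 * j.+1)%N)
  end.
have eB : (\sum_(i < m.+1) p i)%N = n by rewrite -e big_ord_recl.
exists m.+1, (fun i : 'I_m.+1 => p i), (fun i : 'I_m.+1 => B i), eB.
split; first by case=> -[].
rewrite mxdiag_recl castmx_comp /=.
(* Only the proofs of the size equations still differ. *)
by congr (castmx (_, _) _); apply: eq_irrelevance.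
Qed.

(** * Existence of standard-form labels, and final assembly *)

Lemma extend_ord (T : Type) n (x0 : T) (f : 'I_n -> T) :
  exists b : nat -> T, forall i : 'I_n, b i = f i.
Proof. by exists (oapp f x0 \o insub) => i; rewrite /= valK. Qed.

Lemma antidiagonal_standard_even (F : fieldType) n m (A : 'M[F]_n) :
  n = (2 * m)%N -> exists a, standard_form_even m A a.
Proof.
move=> nE; have [b bE] := extend_ord 0 (fun i => A i (rev_ord i)).
(* For even size, [a_k] is the antidiagonal entry in the row listed in place [k]; the predecessor
   turns the 1-based label into a 0-based place. *)
exists (fun k => b (zigzag n k.-1)) => j i k j_m iE kE.
have ik : k = rev_ord i by apply: ord_inj; rewrite /=; lia.
have -> : zigzag n (2 * j - 1).-1 = i by rewrite /zigzag; case: ifP; lia.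
have -> : zigzag n (2 * j).-1 = k by rewrite /zigzag; case: ifP; lia.
by rewrite !bE ik rev_ordK.
Qed.

Lemma antidiagonal_standard_odd (F : fieldType) n m (A : 'M[F]_n) :
  n = (2 * m + 1)%N -> exists a, standard_form_odd m A a.
Proof.
move=> nE; have [b bE] := extend_ord 0 (fun i => A (rev_ord i) i).
exists (fun k => b (zigzag n k.-1)); split=> [i iE|j i k j_m iE kE].
  have ii : i = rev_ord i by apply: ord_inj; rewrite /=; lia.
  have -> : zigzag n 1.-1 = i by rewrite /zigzag; case: ifP; lia.
  by rewrite bE -ii.
have ik : k = rev_ord i by apply: ord_inj; rewrite /=; lia.
have -> : zigzag n (2 * j + 1).-1 = k by rewrite /zigzag; case: ifP; lia.
have -> : zigzag n (2 * j).-1 = i by rewrite /zigzag; case: ifP; lia.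
by rewrite !bE ik rev_ordK.
Qed.

(** Moves the cast into the witness, since the existence claims ask for a matrix whose size is
    literally [n]. *)
Lemma perm_similar_castmx (F : fieldType) n k (M : 'M[F]_n) (N : 'M[F]_k) s :
  conjugate_by (perm_mx s) M N ->
  exists e : k = n, perm_similar M (castmx (e, e) N).
Proof.
case=> e MN; exists e, (perm_mx s); split; first exact: perm_mx_is_perm.
by exists erefl; rewrite castmx_id.
Qed.

Lemma special_orthogonal_perm_mx (C : numFieldType) n (s : 'S_n) :
  ~~ odd_perm s -> special_orthogonal (perm_mx s : 'M[C]_n).
Proof.
move=> s_even; split.
- by apply/mxOverP => i j; rewrite !mxE realn.
- by rewrite tr_perm_mx -perm_mxM mulgV perm_mx1.
- by rewrite det_perm (negPf s_even).
Qed.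

Theorem theorem4p3 (R : realType) (n : nat) (A : 'M[R[i]]_n)
    (hA : antidiagonal_mx A) :
  (* (a) *)
  [/\ ~~ odd n -> exists Q : 'M[R[i]]_n,
        [/\ hollow Q, quasidiagonal Q & perm_similar A Q],
      odd n -> exists Q : 'M[R[i]]_n,
        [/\ pseudo_hollow Q, quasidiagonal Q & perm_similar A Q],
      forall (m : nat) (a : nat -> R[i]),
        n = (2 * m)%N -> standard_form_even m A a ->
        let P : 'M[R[i]]_n := P_even R[i] n m in
        [/\ conjugate_by P A (Q_even m a), even_perm_mx P
          & special_orthogonal P]
    & forall (m : nat) (a : nat -> R[i]),
        n = (2 * m + 1)%N -> standard_form_odd m A a ->
        let P : 'M[R[i]]_n := P_odd R[i] n m in
        conjugate_by P A (Q_odd m a) /\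
        (if odd m then odd_perm_mx P else even_perm_mx P)]
  /\
  (* (b) *)
  (~~ odd n ->
    forall (r : seq {set 'I_n * 'I_n})
           (t1 t2 : {set 'I_n * 'I_n} -> 'I_n * 'I_n),
      perm_eq r (enum (antidiagonal_transpose_pairs n)) ->
      (forall tau, tau \in r -> tau = [set t1 tau; t2 tau]) ->
      perm_similar A (pair_sum A r t1 t2))
  /\
  (odd n ->
    forall (c : 'I_n) (r : seq {set 'I_n * 'I_n})
           (t1 t2 : {set 'I_n * 'I_n} -> 'I_n * 'I_n),
      n = (2 * c + 1)%N ->
      perm_eq r (enum (antidiagonal_transpose_pairs n
                         :\ [set (c, c); (c, c)])) ->
      (forall tau, tau \in r -> tau = [set t1 tau; t2 tau]) ->
      perm_similar A
        (block_mx (pair_sum A r t1 t2) 0 0 (A c c *: (1%:M : 'M[R[i]]_1)))).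
Proof.
have [s [sE s_odd]] := zigzag_perm n.
split; last by split=> [n_even|_ c] r t1 t2;
  [exact: perm_similar_pair_sum_even | exact: perm_similar_pair_sum_odd].
split=> [n_even|n_odd|m a nE Aa|m a nE Aa].
- have nE : n = (2 * n./2)%N by lia.
  have [a Aa] := antidiagonal_standard_even A nE.
  have /perm_similar_castmx[e AQ] := conjugate_by_P_even hA nE Aa sE.
  exists (castmx (e, e) (Q_even n./2 a)).
  by split=> //; [exact: hollow_Q_even | exact: quasidiagonal_Q_even].
- have nE : n = (2 * n./2 + 1)%N by lia.
  have [a Aa] := antidiagonal_standard_odd A nE.
  have /perm_similar_castmx[e AQ] := conjugate_by_P_odd hA nE Aa sE.
  exists (castmx (e, e) (Q_odd n./2 a)).
  by split=> //; [exact: pseudo_hollow_Q_odd | exact: quasidiagonal_Q_odd].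
- have s_even : ~~ odd_perm s^-1 by rewrite odd_permV s_odd; lia.
  rewrite (P_evenE _ nE sE) /=; split; first exact: conjugate_by_P_even.
    by exists s^-1%g.
  exact: special_orthogonal_perm_mx.
rewrite (P_oddE _ nE sE) /=; split; first exact: conjugate_by_P_odd.
(* For [n = 2 * m + 1] the zigzag has the parity of [n./2], which is [m]. *)
have sm : odd_perm s^-1 = odd m.
  have [n_odd n_half] : odd n /\ n./2 = m by split; lia.
  by rewrite odd_permV s_odd n_odd n_half.
by case: ifPn => m_odd; exists s^-1%g; rewrite sm.
Qed.
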